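(* Fix $\beta>0$ and $\eta>0$. Suppose that the Fractional Generalized Perturbed-Greedy algorithm (fGPG) with parameter $\beta$ is $\eta$-competitive, i.e. on every instance of Online Budgeted Allocation its expected total reward is at least $\eta\cdot\mathrm{OPT}$. Then the Generalized Perturbed-Greedy algorithm (GPG) with the same parameter $\beta$ is $\frac{\eta}{1+\gamma}$-competitive: on every instance, its expected total reward is at least $\frac{\eta}{1+\gamma}\,\mathrm{OPT}$, where $\gamma=\max_{i\in I,t\in T} b_{it}/B_i$ is the bid-to-budget ratio of that instance.
   Context: Online Budgeted Allocation (OBA): a finite set $I$ of $n$ resources, each with budget $B_i>0$ and per-unit reward $r_i>0$; arrivals $t=1,\dots,T$ arrive sequentially, and on arrival of $t$ the bids $b_{it}\ge 0$, $i\in I$, are revealed. Each arrival must be immediately and irrevocably matched to at most one resource; matching $t$ to $i$ consumes $b_{it}$ units of $i$'s budget and earns reward $r_i$ per unit consumed, with the total reward from $i$ capped at $r_iB_i$ (equivalently, if $i$ has remaining budget $R<b_{it}$ only $R$ units are consumed). $\mathrm{OPT}$ denotes the total reward of an optimal offline (integral) allocation that knows all bids and budgets. Let $g(x)=e^{\beta(x-1)}$. GPG (budget oblivious): draw independent seeds $y_i\sim U[0,1]$, $i\in I$; maintain the set of resources with nonzero remaining budget (initially $I$). For each arrival $t$, match $t$ to $i^*=\arg\max_{i} b_{it}r_i(1-g(y_i))$ over resources still in the set; if $i^*$ is then out of budget, remove it from the set. GPG never uses the values $B_i$ except to learn when a budget is exhausted. fGPG (fractional, budget aware): draw the same kind of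 seeds $Y=(y_i)$. Time runs continuously in $[1,T+1)$, with $b_{i\tau}:=b_{it}$ for $\tau\in[t,t+1)$. Set $x_i(1)=0$. At each time $\tau$, let $I(\tau)=\{i: x_i(\tau)<B_i\}$, $i^*(\tau)=\arg\max_{i\in I(\tau)} b_{i\tau}r_i(1-g(y_i))$, and evolve $\frac{dx_i(\tau)}{d\tau}=\mathbb{1}(i=i^*(\tau))\,b_{i\tau}$. Arrival $t$ is allocated $x_i(t+1)-x_i(t)$ of $i$'s budget, and the total reward is $\sum_i r_i x_i(T+1)$. Ties in bid prices occur with probability $0$. *)

(* Defs.v *)
From HB Require Import structures.
From mathcomp Require Import all_boot all_order all_algebra.
From mathcomp Require Import all_classical all_reals all_analysis.

Set Implicit Arguments.
Unset Strict Implicit.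
Unset Printing Implicit Defensive.

Import Order.TTheory GRing.Theory Num.Theory.
Import numFieldNormedType.Exports.

Local Open Scope classical_set_scope.
Local Open Scope ring_scope.

(* An instance of Online Budgeted Allocation. The arrival of index k : 'I_narr
   (counted from 0) is the arrival t = k + 1 of the usual numbering from 1. *)
Record oba (R : realType) := OBA {
  nres : nat;
  narr : nat;
  budget : 'I_nres -> R;
  reward : 'I_nres -> R;
  bid : 'I_nres -> 'I_narr -> R;
  budget_gt0 : forall i, 0 < budget i;
  reward_gt0 : forall i, 0 < reward i;
  bid_ge0 : forall i k, 0 <= bid i k
}.

Section Instance.
Variables (R : realType) (O : oba R).
Implicit Types (x y : 'I_(nres O) -> R) (k : 'I_(narr O)) (i : 'I_(nres O)).

(* None leaves the arrival unmatched. *)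
Definition allocation := {ffun 'I_(narr O) -> option 'I_(nres O)}.

Definition allocation_reward (a : allocation) : R :=
  \sum_i reward i * Num.min (budget i) (\sum_(k | a k == Some i) bid i k).

(* The default 0 is harmless: allocation rewards are nonnegative, and the
   allocation matching nothing has reward 0. *)
Definition OPT : R := \big[Num.max/0]_(a : allocation) allocation_reward a.

(* Bids being nonnegative, the default 0 only matters when there is no
   resource or no arrival. *)
Definition bid_budget_ratio : R :=
  \big[Num.max/0]_(i < nres O) \big[Num.max/0]_(k < narr O) (bid i k / budget i).

Variable beta : R.

Definition g (s : R) : R := expR (beta * (s - 1)).

Definition bid_price y k i : R := bid i k * reward i * (1 - g (y i)).

Definition available x : {set 'I_(nres O)} := [set i | x i < budget i]%SET.

(* argmax of the bid prices over A, None if A is empty. Ties are broken in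
   favour of the least index; for almost every seed vector they can only occur
   between zero bids, where the choice affects neither budgets nor rewards. *)
Definition best (A : {set 'I_(nres O)}) y k : option 'I_(nres O) :=
  [pick i in A | [forall j in A, bid_price y k j <= bid_price y k i]].

(* The state x records the consumed budgets. *)
Definition GPG_step y x k : 'I_(nres O) -> R := fun i =>
  if best (available x) y k == Some i then Num.min (budget i) (x i + bid i k)
  else x i.

Definition GPG_consumed y : 'I_(nres O) -> R :=
  foldl (GPG_step y) (fun=> 0) (enum 'I_(narr O)).

Definition GPG_reward y : R := \sum_i reward i * GPG_consumed y i.

(* x tau i is the amount of budget of i consumed by fGPG by time tau, for tau
   in [1, T + 1]. The right-hand side of the evolution equation is a step
   function of tau, continuous from the right; the equation is therefore
   required for the right derivative, at every tau in [1, T + 1), together with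
   the continuity of x. This determines x uniquely on [1, T + 1]. *)
Definition is_fGPG_run y (x : R -> 'I_(nres O) -> R) : Prop :=
  [/\ forall i, x 1 i = 0,
      forall i, {within `[1, (narr O).+1%:R], continuous (x ^~ i)}
    & forall k (tau : R) i, k.+1%:R <= tau < k.+2%:R ->
        h^-1 * (x (tau + h) i - x tau i) @[h --> 0^'+] -->
        (best (available (x tau)) y k == Some i)%:R * bid i k].

Definition fGPG_reward (x : R -> 'I_(nres O) -> R) : R :=
  \sum_i reward i * x (narr O).+1%:R i.

End Instance.

(* n mutually independent seeds, uniform on [0, 1], on some probability space.
   Taking A i = setT outside a subfamily, the product rule below gives the one
   for every subfamily. *)
Record seeds (R : realType) (n : nat) := Seeds {
  seed_disp : measure_display;
  seed_space : measurableType seed_disp;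
  seed_prob : probability seed_space R;
  seed : 'I_n -> {RV seed_prob >-> R};
  seed_uniform : forall i (A : set R), measurable A ->
    distribution seed_prob (seed i) A = uniform_prob (@ltr01 R) A;
  seed_indep : forall A : 'I_n -> set R, (forall i, measurable (A i)) ->
    seed_prob (\bigcap_i (seed i @^-1` A i)) =
    (\prod_(i < n) seed_prob (seed i @^-1` A i))%E
}.

Definition seed_at (R : realType) (n : nat) (S : seeds R n) (w : seed_space S) :
  'I_n -> R := fun i => @seed R n S i w.

(* Since runs of fGPG exist and are unique, x w is the run for the seeds drawn
   at the sample point w. *)
Definition fGPG_competitive (R : realType) (beta eta : R) : Prop :=
  forall (O : oba R) (S : seeds R (nres O))
    (x : seed_space S -> R -> 'I_(nres O) -> R),
    (forall w, is_fGPG_run beta (seed_at w) (x w)) ->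
    ((eta * OPT O)%:E <= 'E_(seed_prob S)[fun w => fGPG_reward (x w)])%E.

(* Main.v *)
Require Import Defs.
From HB Require Import structures.
From mathcomp Require Import all_boot all_order all_algebra.
From mathcomp Require Import all_classical all_reals all_analysis.
From mathcomp Require Import lra.

Import Order.TTheory GRing.Theory Num.Theory.

Local Open Scope ring_scope.

(** Divide all the bids of the instance by [1 + gamma], keeping budgets and
    rewards. Bid prices are all scaled by the same factor, so priorities do not
    change, and the optimum shrinks at most by the factor [1 + gamma]. For every
    seed vector, fGPG on the shrunk instance consumes at most as much of each
    resource as GPG does on the original one. Indeed, as long as GPG has used
    [u i < B i] of [i], fGPG has used at most [u i / (1 + gamma)]; hence [i]
    stays available to fGPG during the whole next arrival, since
    [(u i + b) / (1 + gamma) < B i]. The resources available to fGPG thus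
    include those available to GPG, so that the best resource for fGPG, when it
    is available to GPG, is also the best one for GPG. Expectations compare
    pointwise, and competitiveness of fGPG on the shrunk instance concludes. *)

Set Implicit Arguments.
Unset Strict Implicit.
Unset Printing Implicit Defensive.

Import numFieldNormedType.Exports.

Local Open Scope classical_set_scope.

(** * Auxiliary facts on filtered lists, expectations and continuity *)

(** No element before [i] satisfies [Q], hence none satisfies [P]. This carries the least-index
    tie-breaking of [best] over to a smaller set. *)
Lemma ohead_filter_sub (T : eqType) (P Q : pred T) (s : seq T) (i : T) :
  subpred P Q -> P i -> ohead (seq.filter Q s) = Some i ->
  ohead (seq.filter P s) = Some i.
Proof.
move=> PQ Pi; elim: s => //= a s IHs.
case: ifP => [Qa [ai]|Qa]; first by rewrite ai Pi.
by case: ifP => // /PQ; rewrite Qa.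
Qed.

(** The integral of a nonnegative function is a supremum over the simple functions below it, and a
    larger function has more of them. This spares a proof that rewards are measurable in the sample
    point. *)
Lemma expectation_le_ge0 d (T : measurableType d) (R : realType)
    (P : probability T R) (X Y : T -> R) :
  (forall w, 0 <= X w) -> (forall w, X w <= Y w) -> ('E_P[X] <= 'E_P[Y])%E.
Proof.
move=> X0 XY; have Y0 w : 0 <= Y w by rewrite (le_trans (X0 w)).
rewrite unlock !ge0_integralTE => [|w|w]; rewrite ?lee_fin //.
apply: le_ereal_sup => _ [h hX <-].
by exists h => // w; apply: le_trans (hX w) _; rewrite lee_fin.
Qed.

Lemma lipschitz_mono_continuous (R : realType) (f : R -> R) (C : R) :
  0 <= C -> (forall s t, s <= t -> 0 <= f t - f s <= C * (t - s)) ->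
  continuous f.
Proof.
move=> C0 fC s; apply/cvgrPdist_le => e e0.
(* [C + 1] rather than [C] keeps the denominator positive when [C = 0]. *)
have d0 : 0 < e / (C + 1) by rewrite divr_gt0 // ltr_wpDl.
have Cd : C * (e / (C + 1)) <= e.
  by rewrite mulrA ler_pdivrMr ?ltr_wpDl // mulrC ler_pM2l // lerDl.
near=> t.
have : `|s - t| <= e / (C + 1) by near: t; exact: cvgr_dist_le d0.
move=> /(ler_wpM2l C0) /le_trans/(_ Cd); apply: le_trans.
have [st|ts] := leP s t.
- have /andP[f0 f1] := fC _ _ st.
  by rewrite distrC (distrC s) ger0_norm // (ger0_norm (x := t - s)) // subr_ge0.
- have /andP[f0 f1] := fC _ _ (ltW ts).
  by rewrite ger0_norm // (ger0_norm (x := s - t)) // subr_ge0 ltW.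
Unshelve. all: by end_near. Qed.

(** * Restricting an argmax to a smaller set *)

Section Best.
Variables (R : realType) (O : oba R) (beta : R).
Implicit Types (A B : {set 'I_(nres O)}) (y : 'I_(nres O) -> R).

Lemma best_mem A y k i : best beta A y k = Some i -> i \in A.
Proof. by rewrite /best; case: pickP => // j /andP[jA _] [<-]. Qed.

Lemma best_set0 y k : best beta (finset.set0 : {set 'I_(nres O)}) y k = None.
Proof. by rewrite /best; case: pickP => // j; rewrite inE. Qed.

(** Since [i] lies in [A], every maximiser over [A] reaches the maximum over [B]; the first
    maximiser over [B] is therefore also the first over [A]. *)
Lemma best_sub A B y k i :
  A \subset B -> i \in A -> best beta B y k = Some i -> best beta A y k = Some i.
Proof.
move=> AB iA bestB.
have maxi j : j \in B -> bid_price beta y k j <= bid_price beta y k i.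
  move: bestB; rewrite /best; case: pickP => // j' /andP[_ /forall_inP m] [<-].
  exact: m.
move: bestB; rewrite /best /pick /enum_mem; apply: ohead_filter_sub.
- move=> j /andP[jA /forall_inP mj]; apply/andP; split.
    exact: (fintype.subsetP AB).
  apply/forall_inP => l lB.
  by apply: le_trans (maxi _ lB) _; exact: mj.
- apply/andP; split=> //; apply/forall_inP => l lA.
  by apply: maxi; exact: (fintype.subsetP AB).
Qed.

End Best.

(** * The fractional flow during one arrival *)

Section Run.
Variables (R : realType) (O : oba R) (beta : R) (y : 'I_(nres O) -> R).
Implicit Types (x : 'I_(nres O) -> R) (k : 'I_(narr O)) (i j : 'I_(nres O)).

Local Notation bst x k := (best beta (available x) y k).

Definition update x i (v : R) : 'I_(nres O) -> R :=
  fun j => if j == i then v else x j.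

(* The state reached by fGPG from x after spending time s on arrival k. Every
   recursive call exhausts a resource, so that n bounds the number of switches
   between resources. *)
Fixpoint flow (n : nat) k x (s : R) : 'I_(nres O) -> R :=
  if n isn't n'.+1 then x else
  if bst x k isn't Some i then x else
  if s * bid i k < budget i - x i then update x i (x i + s * bid i k)
  else flow n' k (update x i (budget i)) (s - (budget i - x i) / bid i k).

Lemma available_update_full x i :
  available (update x i (budget i)) = (available x :\ i)%SET.
Proof.
apply/setP => j; rewrite !inE /update.
by have [->|] := eqVneq j i; rewrite ?ltxx.
Qed.

Lemma available_update x i v : i \in available x -> v < budget i ->
  available (update x i v) = available x.
Proof.
rewrite inE => xi vi; apply/setP => j; rewrite !inE /update.
by have [->|//] := eqVneq j i; rewrite vi xi.
Qed.

Lemma card_available_update n x i : i \in available x ->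
  (#|available x| <= n.+1)%N ->
  (#|available (update x i (budget i))| <= n)%N.
Proof. by move=> ix; rewrite available_update_full (cardsD1 i) ix. Qed.

(** The failed comparison is the test made by [flow]. A zero bid could not use up a positive
    remaining budget, so the exhaustion time is a genuine quotient. *)
Lemma switch_time x i k (s : R) : i \in available x ->
  (s * bid i k < budget i - x i) = false -> 0 <= s ->
  [/\ 0 < bid i k, 0 < (budget i - x i) / bid i k
    & (budget i - x i) / bid i k <= s].
Proof.
rewrite inE -subr_gt0 => xi /negbT; rewrite -leNgt => le_s s0.
have b0 : 0 < bid i k.
  rewrite lt_def bid_ge0 andbT; apply/eqP => b0.
  by move: le_s; rewrite b0 mulr0 leNgt xi.
by rewrite ler_pdivrMr // divr_gt0.
Qed.

Lemma flow0 n k x i : flow n k x 0 i = x i.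
Proof.
case: n => //= n; case E : (best _ _ _ _) => [j|] //.
rewrite mul0r subr_gt0; have := best_mem E; rewrite inE => ->.
by rewrite /update addr0; case: eqP => [->|].
Qed.

Lemma flow_le_budget n k x (s : R) : (forall i, x i <= budget i) ->
  forall i, flow n k x s i <= budget i.
Proof.
elim: n x s => //= n IHn x s xB i; case E : (best _ _ _ _) => [j|] //.
case: ifP => [sb|_].
- by rewrite /update; case: eqP => // ->; rewrite -lerBrDl ltW.
- by apply: IHn => l; rewrite /update; case: eqP => // ->.
Qed.

Lemma flow_lipschitz n k x (s t : R) i : 0 <= s <= t ->
  0 <= flow n k x t i - flow n k x s i <= bid i k * (t - s).
Proof.
have trivial_case (v u w : R) j : u <= w -> 0 <= v - v <= bid j k * (w - u).
  by move=> uw; rewrite subrr lexx mulr_ge0 ?bid_ge0 // subr_ge0.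
elim: n x s t => [|n IHn] x s t /andP[s0 st] /=; first exact: trivial_case.
case E : (best _ _ _ _) => [j|]; last exact: trivial_case.
have jx := best_mem E.
case: ifP => [tb|tb].
- rewrite (le_lt_trans _ tb) ?ler_wpM2r ?bid_ge0 // /update.
  case: eqP => [->|_]; last exact: trivial_case.
  rewrite opprD addrACA subrr add0r -mulrBl mulrC lexx andbT.
  by rewrite mulr_ge0 ?bid_ge0 // subr_ge0.
- have [b0 d0 dt] := switch_time jx tb (le_trans s0 st).
  set d := (budget j - x j) / bid j k in d0 dt *.
  have dE : budget j - x j = bid j k * d by rewrite mulrC divfK // gt_eqF.
  case: ifP => [sb|sb].
  (* Here [j] is exhausted between [s] and [t]. The increment splits at [d]: linear growth of [j] up
     to [d], then the recursive flow from time 0 to [t - d]. *)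
  + have sd : s <= d by rewrite ler_pdivlMr // ltW.
    have /(IHn (update x j (budget j))) : 0 <= (0 : R) <= t - d.
      by rewrite lexx subr_ge0.
    rewrite flow0 subr0; set F := flow _ _ _ _ _; rewrite /update.
    case: eqP => [->|_].
    * rewrite (_ : F - (x j + s * bid j k) =
        (F - budget j) + bid j k * (d - s)); last by rewrite mulrBr -dE; lra.
      move=> /andP[F0 F1]; apply/andP; split.
        by rewrite addr_ge0 // mulr_ge0 ?subr_ge0 // ltW.
      rewrite (_ : t - s = (t - d) + (d - s)); last by lra.
      by rewrite (mulrDr _ (t - d)) lerD2r.
    * move=> /andP[-> /le_trans]; apply; apply: ler_wpM2l; first exact: bid_ge0.
      by lra.
  + have [_ _ ds] := switch_time jx sb s0.
    have /(IHn (update x j (budget j))) : 0 <= s - d <= t - d.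
      by rewrite subr_ge0 ds lerD2r.
    by rewrite (_ : t - d - (s - d) = t - s); last lra.
Qed.

(** The best resource stays the same for a short while after any time. The cardinality bound ensures
    that the recursion does not stop while a resource is still available. *)
Lemma flow_right_linear n k x (s : R) :
  (#|available x| <= n)%N -> 0 <= s ->
  exists2 d : R, 0 < d & forall h, 0 <= h < d -> forall i,
    flow n k x (s + h) i =
    flow n k x s i + h * ((bst (flow n k x s) k == Some i)%:R * bid i k).
Proof.
elim: n x s => [|n IHn] x s cx s0 /=.
  move: cx; rewrite leqn0 cards_eq0 => /eqP ->.
  by exists 1 => // h _ i; rewrite best_set0 mul0r mulr0 addr0.
case E : (best _ _ _ _) => [j|]; last first.
  by exists 1 => // h _ i; rewrite E mul0r mulr0 addr0.
have jx := best_mem E.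
case: ifP => [sb|sb].
(* From [h * (bid j k + 1)] below the remaining budget follows [h * bid j k] below it; adding 1
   covers a zero bid. *)
- exists ((budget j - x j - s * bid j k) / (bid j k + 1)) => [|h /andP[h0 hd] i].
    by rewrite divr_gt0 ?subr_gt0 // ltr_wpDl ?bid_ge0.
  have shb : (s + h) * bid j k < budget j - x j.
    have b1 : 0 < bid j k + 1 by rewrite ltr_wpDl ?bid_ge0.
    by move: hd; rewrite ltr_pdivlMr // mulrDr mulrDl; lra.
  rewrite shb available_update //; last by move: sb; lra.
  rewrite E /update (eq_sym (Some j)).
  rewrite (_ : (Some i == Some j) = (i == j)) //.
  by case: eqP => [->|_]; [rewrite mul1r mulrDl addrA|rewrite mul0r mulr0 addr0].
- have [b0 _ ds] := switch_time jx sb s0.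
  have [||d d0 dP] := IHn (update x j (budget j)) (s - (budget j - x j) / bid j k).
  + exact: card_available_update.
  + by rewrite subr_ge0.
  exists d => // h hd i; have h0 : 0 <= h by case/andP: hd.
  rewrite ifF; last first.
    apply/negbTE; rewrite -leNgt mulrDl.
    by move/negbT: sb; rewrite -leNgt => /le_trans -> //; rewrite lerDl mulr_ge0 // ltW.
  by rewrite addrAC dP.
Qed.

(** * Gluing the arrivals into a run of fGPG *)

Definition arrival_flow k x (s : R) := flow (nres O) k x s.

(** The state at time [m + 1]: arrival [k] occupies the times from [k + 1] to [k + 2], and starts
    from [state k]. *)
Definition state (m : nat) : 'I_(nres O) -> R :=
  foldl (fun x k => arrival_flow k x 1) (fun=> 0) (take m (enum 'I_(narr O))).

Lemma stateS k : state k.+1 = arrival_flow k (state k) 1.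
Proof.
rewrite /state (take_nth k) ?size_enum_ord // foldl_rcons.
by rewrite nth_ord_enum.
Qed.

(** At [tau - k.+1%:R], this is the time already spent on arrival [k] by time [tau]. *)
Definition clamp (s : R) : R := Num.max 0 (Num.min s 1).

Lemma clamp_ge0 s : 0 <= clamp s.
Proof. by rewrite /clamp le_max lexx. Qed.

Lemma clamp_lipschitz s t : s <= t -> clamp s <= clamp t <= clamp s + (t - s).
Proof.
rewrite /clamp => st; rewrite /Num.max /Num.min.
by do !case: ifP; move=> *; lra.
Qed.

Lemma clamp_le0 s : s <= 0 -> clamp s = 0.
Proof. by move=> s0; rewrite /clamp max_l // ge_min s0. Qed.

Lemma clamp_ge1 s : 1 <= s -> clamp s = 1.
Proof. by move=> s1; rewrite /clamp min_r // max_r. Qed.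

Lemma clamp_id s : 0 <= s <= 1 -> clamp s = s.
Proof. by move=> /andP[s0 s1]; rewrite /clamp min_l // max_r. Qed.

(* A sum of the contributions of the arrivals, rather than a definition by cases
   on the current arrival: continuity in tau is then immediate. *)
Definition fGPG_run (tau : R) i : R :=
  \sum_(k < narr O)
    (arrival_flow k (state k) (clamp (tau - k.+1%:R)) i - state k i).

Lemma fGPG_run_lipschitz (s t : R) i : s <= t ->
  0 <= fGPG_run t i - fGPG_run s i <= (\sum_(k < narr O) bid i k) * (t - s).
Proof.
move=> st; rewrite /fGPG_run -sumrB mulr_suml.
have H k : 0 <= arrival_flow k (state k) (clamp (t - k.+1%:R)) i - state k i -
   (arrival_flow k (state k) (clamp (s - k.+1%:R)) i - state k i)
   <= bid i k * (t - s).
  have /clamp_lipschitz/andP[c1 c2] : s - k.+1%:R <= t - k.+1%:R by rewrite lerD2r.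
  have /(@flow_lipschitz (nres O) k (state k) _ _ i) :
    0 <= clamp (s - k.+1%:R) <= clamp (t - k.+1%:R) by rewrite clamp_ge0.
  rewrite -/(arrival_flow _ _ _) -/(arrival_flow _ _ _) => /andP[a1 a2].
  apply/andP; split; first by lra.
  apply: (@le_trans _ _ (bid i k * (clamp (t - k.+1%:R) - clamp (s - k.+1%:R)))).
    by lra.
  by apply: ler_wpM2l; [exact: bid_ge0|lra].
by rewrite sumr_ge0 ?ler_sum // => k _; have /andP[] := H k.
Qed.

Lemma fGPG_run_arrival k (tau : R) i : k.+1%:R <= tau <= k.+2%:R ->
  fGPG_run tau i = arrival_flow k (state k) (tau - k.+1%:R) i.
Proof.
move=> /andP[kt tk].
(* Freezing the index at [k] kills the terms from [k] on, so that a sum over all arrivals telescopes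
   to [state k] and can be compared with the run term by term. *)
pose st m := state (minn m k) i.
have telescope : \sum_(j < narr O) (st j.+1 - st j) = state k i.
  rewrite -(big_mkord xpredT (fun j : nat => st j.+1 - st j)) telescope_sumr //.
  by rewrite /st min0n (minn_idPr (ltnW (ltn_ord k))) /state take0 subr0.
rewrite /fGPG_run (bigD1 k) //= clamp_id; last first.
  by rewrite subr_ge0 kt lerBlDr -natr1 addrC in tk *.
rewrite -[RHS](subrK (state k i)) -telescope (bigD1 k) //= /st.
rewrite (minn_idPr (leqnSn k)) minnn subrr add0r; congr (_ + _).
apply: eq_bigr => j; rewrite neq_ltn => /orP[jk|kj].
- rewrite clamp_ge1; last first.
    by rewrite lerBrDr (le_trans _ kt) // nat1r ler_nat ltnS.
  by rewrite -stateS (minn_idPl jk) (minn_idPl (ltnW jk)).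
- rewrite clamp_le0; last by rewrite subr_le0 (le_trans tk) // ler_nat ltnS.
  by rewrite /arrival_flow flow0 (minn_idPr (ltnW kj)) (minn_idPr (leqW (ltnW kj))) !subrr.
Qed.

Lemma fGPG_run_end i : fGPG_run (narr O).+1%:R i = state (narr O) i.
Proof.
rewrite /fGPG_run (eq_bigr (fun k : 'I__ => state k.+1 i - state k i)); last first.
  move=> k _; rewrite clamp_ge1 ?stateS //.
  by rewrite lerBrDr nat1r ler_nat ltnS.
rewrite -(big_mkord xpredT (fun j : nat => state j.+1 i - state j i)) telescope_sumr //.
by rewrite /state take0 subr0.
Qed.

(** Competitiveness speaks of given runs, so a run must be exhibited for every seed vector before it
    can be applied. *)
Lemma is_fGPG_run_fGPG_run : is_fGPG_run beta y fGPG_run.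
Proof.
split=> [i|i|k tau i /andP[kt tk]].
- rewrite /fGPG_run big1 // => k _; rewrite clamp_le0.
    by rewrite /arrival_flow flow0 subrr.
  by rewrite subr_le0 ler1n.
- apply: continuous_subspaceT.
  apply: (@lipschitz_mono_continuous _ _ (\sum_(k < narr O) bid i k)).
    by apply: sumr_ge0 => k _; exact: bid_ge0.
  by move=> s t; exact: fGPG_run_lipschitz.
- have runE : fGPG_run tau = arrival_flow k (state k) (tau - k.+1%:R).
    by apply/funext => j; apply: fGPG_run_arrival; rewrite kt ltW.
  have [||d d0 dP] := @flow_right_linear (nres O) k (state k) (tau - k.+1%:R).
  + by rewrite -[leqRHS](card_ord (nres O)) max_card.
  + by rewrite subr_ge0.
  (* The flow is affine in small [h >= 0], so the difference quotient is constant near 0. The bound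
     [hk] keeps [tau + h] within arrival [k]. *)
  apply: cvg_near_cst; near=> h.
  have h0 : 0 < h by near: h; exact: nbhs_right_gt.
  have hd : h < d by near: h; exact: nbhs_right_lt.
  have hk : h < k.+2%:R - tau by near: h; apply: nbhs_right_lt; rewrite subr_gt0.
  rewrite (@fGPG_run_arrival k); last by apply/andP; split; lra.
  rewrite runE addrAC /arrival_flow dP ?hd ?(ltW h0) //.
  by rewrite addrAC subrr add0r mulrA mulVf ?gt_eqF // mul1r.
Unshelve. all: by end_near. Qed.

End Run.

(** * Dividing all bids by a constant *)

Section Shrink.
Variables (R : realType) (O : oba R).

Definition shrink (c : R) (c0 : 0 <= c) : oba R :=
  @OBA R (nres O) (narr O) (@budget R O) (@reward R O)
    (fun i k => bid i k / c) (@budget_gt0 R O) (@reward_gt0 R O)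
    (fun i k => divr_ge0 (bid_ge0 i k) c0).

Lemma bid_budget_ratio_ge0 : 0 <= bid_budget_ratio O.
Proof. exact: bigmax_ge_id. Qed.

Lemma bid_le_ratio (i : 'I_(nres O)) (k : 'I_(narr O)) : bid i k <= bid_budget_ratio O * budget i.
Proof.
rewrite -ler_pdivrMr ?budget_gt0 //.
by apply: le_trans (le_bigmax _ _ i); exact: (le_bigmax _ (fun k => bid i k / _)).
Qed.

Variables (beta c : R) (c_gt0 : 0 < c) (c_ge0 : 0 <= c).
Local Notation O' := (shrink c_ge0).

Lemma best_shrink (A : {set 'I_(nres O)}) (y : 'I_(nres O) -> R) k :
  best beta (O := O') A y k = best beta A y k.
Proof.
apply: eq_pick => i; congr (_ && _); apply: eq_forallb => j; congr (_ ==> _).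
rewrite /bid_price /= !(mulrAC _ c^-1).
by rewrite ler_pM2r ?invr_gt0.
Qed.

(** For a fixed allocation, a resource with budget [B] and total bid [s] satisfies [c * min(B, s /
    c) = min(c * B, s) >= min(B, s)]. *)
Lemma OPT_shrink : 1 <= c -> OPT O / c <= OPT O'.
Proof.
move=> c1; rewrite ler_pdivrMr //.
have O'0 : 0 <= OPT O' by exact: bigmax_ge_id.
apply: bigmax_le => [|a _]; first by rewrite mulr_ge0.
apply: (@le_trans _ _ (allocation_reward (O := O') a * c)); last first.
  by rewrite ler_pM2r //; exact: (le_bigmax _ (@allocation_reward R O')).
rewrite /allocation_reward mulr_suml; apply: ler_sum => i _ /=.
rewrite -mulrA ler_pM2l ?reward_gt0 // -mulr_suml.
rewrite minr_pMl // divfK ?gt_eqF // le_min !ge_min lexx orbT andbT.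
by rewrite ler_peMr ?orbT // ltW // budget_gt0.
Qed.

End Shrink.

(** * Coupling fGPG on the shrunk instance with GPG on the original one *)

Section Comparison.
Variables (R : realType) (O : oba R) (beta : R) (y : 'I_(nres O) -> R).
Variables (c : R) (c_gt0 : 0 < c) (c_ge0 : 0 <= c).
Hypothesis cP : forall (i : 'I_(nres O)) k, budget i + bid i k <= c * budget i.
Local Notation O' := (shrink O c_ge0).

(** [A] stands for the resources available to GPG. They cannot be exhausted within time [s], so all
    of [A] stays available to fGPG; if fGPG ever serves a resource of [A], it is the best one of
    [A], and it is served for at most time [s]. *)
Lemma flow_shrink_le n k (x v : 'I_(nres O) -> R) (A : {set 'I_(nres O)}) (s : R) :
  0 <= s ->
  (forall j, j \in A -> x j <= v j) ->
  (forall j, j \in A -> v j + s * (bid j k / c) < budget j) ->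
  forall j, j \in A -> flow (O := O') beta y n k x s j <=
    v j + (best beta A y k == Some j)%:R * (s * (bid j k / c)).
Proof.
move=> s0; elim: n x s s0 => [|n IHn] x s s0 xv vB j jA.
  rewrite (le_trans (xv _ jA)) //= lerDl.
  by rewrite !mulr_ge0 ?bid_ge0 ?ler0n ?invr_ge0.
have bc0 l : 0 <= bid l k / c by rewrite mulr_ge0 ?bid_ge0 ?invr_ge0.
have AO : A \subset available (O := O') x.
  apply/fintype.subsetP => l lA; rewrite inE /=.
  rewrite (le_lt_trans (xv _ lA)) // (le_lt_trans _ (vB _ lA)) // lerDl.
  by rewrite mulr_ge0.
have grow (e : bool) : x j <= v j + e%:R * (s * (bid j k / c)).
  by rewrite (le_trans (xv _ jA)) // lerDl mulr_ge0 ?ler0n // mulr_ge0.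
rewrite /=; case E : best => [i|] //.
have ix := best_mem E.
case: ifP => [sb|sb].
- rewrite /update; case: eqP => [ji|_] //.
  subst i; move: E; rewrite best_shrink // => /(best_sub AO jA) ->.
  by rewrite eqxx mul1r lerD2r xv.
(* Only a resource outside [A] can be exhausted, so the switch preserves both bounds on [A], with
   less time left. *)
- have iA : i \notin A.
    apply/negP => iA; move/negbT: sb; rewrite -leNgt /=.
    by have := vB _ iA; have := xv _ iA; lra.
  have [_ d0 ds] := switch_time ix sb s0.
  set d := _ / _ in d0 ds; rewrite -[X in s - X]/d.
  have sd : s - d <= s by rewrite gerBl ltW.
  apply: le_trans (IHn _ _ _ _ _ _ jA) _.
  + by rewrite subr_ge0.
  + move=> l lA; rewrite /update; case: eqP => [li|_]; last exact: xv.
    by rewrite -li lA in iA.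
  + move=> l lA; apply: le_lt_trans (vB _ lA); rewrite lerD2l.
    by rewrite ler_wpM2r.
  + by rewrite lerD2l ler_wpM2l ?ler0n // ler_wpM2r.
Qed.

(** Once GPG has exhausted [i], fGPG may go on consuming it, and only the budget bounds its
    consumption. *)
Definition dominated (x u : 'I_(nres O) -> R) :=
  (forall i, x i <= budget i) /\ (forall i, u i < budget i -> c * x i <= u i).

Lemma dominated_step (x u : 'I_(nres O) -> R) k : dominated x u ->
  dominated (arrival_flow (O := O') beta y k x 1) (GPG_step beta y u k).
Proof.
move=> [xB xu]; split; first exact: (@flow_le_budget R O' beta y (nres O) k x 1 xB).
move=> i ui'.
have ui : u i < budget i.
  move: ui'; rewrite /GPG_step; case: ifP => // /eqP/best_mem.
  by rewrite inE.
have iA : i \in available u by rewrite inE.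
apply: (@le_trans _ _ (c * (u i / c +
    (best beta (available u) y k == Some i)%:R * (1 * (bid i k / c))))).
  rewrite ler_pM2l //.
  apply: (@flow_shrink_le _ k x (fun j => u j / c) (available u)) => // j.
  - by rewrite inE => uj; rewrite ler_pdivlMr // mulrC xu.
  (* The bid-to-budget ratio enters here: [u j + bid j k < budget j + bid j k <= c * budget j]. *)
  - rewrite inE => uj; rewrite mul1r -mulrDl ltr_pdivrMr // mulrC.
    by rewrite (lt_le_trans _ (cP j k)) // ltrD2r.
rewrite mul1r mulrA -mulrDl mulrC divfK ?gt_eqF //.
(* As [i] has budget left after the step, a bid matched to it was consumed without truncation. *)
move: ui'; rewrite /GPG_step; case: eqP => _; last by rewrite mul0r addr0.
by rewrite mul1r gt_min ltxx /= => /ltW/min_r ->.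
Qed.

Lemma dominated_state : dominated (state (O := O') beta y (narr O)) (GPG_consumed beta y).
Proof.
rewrite /state /GPG_consumed take_oversize ?size_enum_ord //.
have step l : forall x u, dominated x u ->
    dominated (foldl (fun x k => arrival_flow (O := O') beta y k x 1) x l)
              (foldl (GPG_step beta y) u l).
  by elim: l => //= k l IHl x u xu; exact/IHl/dominated_step.
by apply: step; split=> [i|i _]; rewrite ?mulr0 // ltW // budget_gt0.
Qed.

End Comparison.

(** * Nonnegativity of the states and comparison of the expectations *)

Lemma foldl_invariant (S T : Type) (P : S -> Prop) (f : S -> T -> S) x0 s :
  P x0 -> (forall x t, P x -> P (f x t)) -> P (foldl f x0 s).
Proof. by move=> P0 Pf; elim: s x0 P0 => //= t s IHs x0 P0; exact/IHs/Pf. Qed.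

Lemma state_ge0 (R : realType) (O : oba R) (beta : R) y m i :
  0 <= state (O := O) beta y m i.
Proof.
apply: (foldl_invariant (P := fun u => forall i, 0 <= u i)) i => // u k u0 i.
have /(flow_lipschitz beta y (nres O) k u i)/andP[+ _] : 0 <= (0 : R) <= 1.
  by rewrite lexx ler01.
by rewrite flow0 subr_ge0; exact: le_trans.
Qed.

Theorem theorem2 (R : realType) (beta eta : R)
    (beta_gt0 : 0 < beta) (eta_gt0 : 0 < eta)
    (fGPG_comp : fGPG_competitive beta eta)
    (O : oba R) (S : seeds R (nres O)) :
  ((eta / (1 + bid_budget_ratio O) * OPT O)%:E
    <= 'E_(seed_prob S)[fun w => GPG_reward beta (seed_at w)])%E.
Proof.
set c := 1 + bid_budget_ratio O.
have c1 : 1 <= c by rewrite lerDl bid_budget_ratio_ge0.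
have c_gt0 : 0 < c by rewrite (lt_le_trans ltr01).
have c_ge0 := ltW c_gt0.
have cP (i : 'I_(nres O)) k : budget i + bid i k <= c * budget i.
  by rewrite mulrDl mul1r lerD2l bid_le_ratio.
(* The shrunk instance has the same resources, so the same seeds drive both algorithms and rewards
   can be compared at each sample point. *)
have := fGPG_comp (shrink O c_ge0) S
  (fun w => fGPG_run (O := shrink O c_ge0) beta (seed_at w)).
move=> /(_ (fun w => is_fGPG_run_fGPG_run _ _)).
set E' := ('E_(_)[_])%E => compE.
apply: (@le_trans _ _ E').
  apply: le_trans compE; rewrite lee_fin -mulrA (mulrC c^-1).
  by rewrite ler_pM2l // OPT_shrink.
apply: expectation_le_ge0 => w.
  rewrite /fGPG_reward sumr_ge0 // => i _.
  by rewrite fGPG_run_end mulr_ge0 ?state_ge0 // ltW // reward_gt0.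
rewrite /fGPG_reward /GPG_reward; apply: ler_sum => i _.
rewrite fGPG_run_end /= ler_pM2l ?reward_gt0 //.
have [sB sG] := dominated_state (O := O) beta (seed_at w) c_gt0 c_ge0 cP.
(* With budget left in GPG, [c * x <= u] gives [x <= u] because [1 <= c] and [0 <= x]; otherwise GPG
   has consumed the whole budget, which bounds fGPG. *)
have [/(sG i)|] := ltP (GPG_consumed (O := O) beta (seed_at w) i) (budget (o := O) i).
  by apply: le_trans; rewrite ler_peMl // state_ge0.
exact: le_trans (sB i).
Qed.
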